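(* Let $k$ be a perfect field of characteristic $p>0$, $P$ a finite poset, $R=\mathcal{R}_k[J(P)]$ the Hibi ring and $\mathfrak{m}=R_+$. Then \[ \operatorname{fpt}(\mathfrak{m})=\operatorname{rank}_*\overline{P}=\operatorname{rank}_*P+2 . \] In particular $\operatorname{fpt}(\mathfrak{m})\in\mathbb{N}$.
   Context: Let $P=\{p_1,\dots,p_N\}$ be a finite poset and $J(P)$ the set of poset ideals of $P$ (down-closed subsets, including $\emptyset$ and $P$). The Hibi ring is $\mathcal{R}_k[J(P)]=k[\,T\prod_{p_i\in I}X_i\mid I\in J(P)\,]\subseteq k[T,X_1,\dots,X_N]$, each generator in degree $1$; $\mathfrak{m}=R_+$ is generated by these generators. $\overline{P}=P\cup\{-\infty,\infty\}$ with $-\infty<x<\infty$ for all $x\in P$. $F$-pure threshold: for a real $t\ge0$, the pair $(R,\mathfrak{m}^t)$ is $F$-pure if for all large $q=p^e$ there is $d\in\mathfrak{m}^{\lceil t(q-1)\rceil}$ such that the $R$-linear map $R\to R^{1/q}$, $1\mapsto d^{1/q}$, splits; $\operatorname{fpt}(\mathfrak{m})=\sup\{t\ge0\mid(R,\mathfrak{m}^t)\text{ is }F\text{-pure}\}$. For a finite poset $Q$ (applied to $Q=P$ and $Q=\overline{P}$): $x\lessdot y$ means $x<y$ with no $z$ satisfying $x<z<y$. A path is a sequence $C=(q_1,\dots,q_t)$ of distinct elements of $Q$ with $q_1$ minimal in $Q$, consecutive elements related by $q_i\lessdot q_{i+1}$ or $q_{i+1}\lessdot q_i$, and $q_{t-1}\lessdot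 q_t$ (when $t\ge2$); it is maximal if $q_t$ is maximal in $Q$. For $1<i<t$, $q_i$ is locally maximal if $q_{i-1}\lessdot q_i$ and $q_{i+1}\lessdot q_i$, locally minimal if $q_i\lessdot q_{i-1}$ and $q_i\lessdot q_{i+1}$; $q_1$ counts as locally minimal and $q_t$ as locally maximal. The decomposition $C=A_1+D_1+\cdots+D_{n-1}+A_n$ splits $C$ into consecutive blocks: $A_1$ is $q_1$ through the first locally maximal element, $D_1$ the following elements through the next locally minimal element, $A_2$ the following elements through the next locally maximal element, etc., $A_n$ ending at $q_t$; $t(A_i)$ is the last element of $A_i$, $V(\cdot)$ the set of elements of a block, $\langle A\rangle=\{q\in Q\mid q\le t(A)\}$, and $\langle A_i\setminus t(A_i)\rangle$ the poset ideal generated by the elements of $A_i$ other than $t(A_i)$. $C$ satisfies ( * ) if for all $1\le i\le n-1$: (1) $V(D_i)\cap(\bigcup_{m=1}^{i-1}\langle A_m\rangle\cup\langle A_i\setminus t(A_i)\rangle\cup\{t(A_i)\})=\emptyset$; (2) $V(A_{i+1})\cap\bigcup_{m=1}^{i}\langle A_m\rangle=\emptyset$. $\operatorname{len}^*C=\#\{i\mid q_i\lessdot q_{i+1}\}$, and the lower rank $\operatorname{rank}_*Q$ is the minimum of $\operatorname{len}^*C$ over maximal paths $C$ of $Q$ satisfying ( * ). *)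

(* Defs.v *)
From Stdlib Require Import Reals.
From HB Require Import structures.
From mathcomp Require Import all_boot all_order all_algebra.
From mathcomp Require Import mpoly.

Set Implicit Arguments.
Unset Strict Implicit.
Unset Printing Implicit Defensive.

Import Order.TTheory GRing.Theory.

Section PosetPaths.
Variables (T : finType) (le : rel T).

Definition plt (x y : T) : bool := le x y && (x != y).
Definition pcov (x y : T) : bool := plt x y && ~~ [exists z, plt x z && plt z y].
Definition pminimal (x : T) : bool := ~~ [exists y, plt y x].
Definition pmaximal (x : T) : bool := ~~ [exists y, plt x y].

Section WithDefault.
Variable x0 : T.
Variable C : seq T.
Local Notation q i := (nth x0 C i).
Local Notation t := (size C).

Definition upstep (i : nat) : bool := pcov (q i) (q i.+1).
Definition downstep (i : nat) : bool := pcov (q i.+1) (q i).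

Definition locmax (i : nat) : bool :=
  (i == t.-1) || [&& 0 < i, i < t.-1, upstep i.-1 & downstep i].
Definition locmin (i : nat) : bool :=
  (i == 0) || [&& 0 < i, i < t.-1, downstep i.-1 & upstep i].

Definition is_path : bool :=
  [&& 0 < t, uniq C, pminimal (q 0),
      all (fun i => upstep i || downstep i) (iota 0 t.-1)
    & (1 < t) ==> upstep (t.-2)].

Definition is_maximal_path : bool := is_path && pmaximal (q t.-1).

Definition len_star : nat := count upstep (iota 0 t.-1).

Definition flagged : seq (T * bool * bool) :=
  [seq (q i, locmax i, locmin i) | i <- iota 0 t].
End WithDefault.

(* Cut a flagged sequence into consecutive blocks: an A-block (phase = true)
   runs through the next locally maximal element, a D-block (phase = false)
   through the next locally minimal element. *)
Fixpoint chop (fuel : nat) (phase : bool) (s : seq (T * bool * bool))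
  : seq (seq T) :=
  match fuel with
  | 0 => [::]
  | fuel'.+1 =>
    if s is [::] then [::] else
    let k := find (fun x : T * bool * bool =>
                     if phase then x.1.2 else x.2) s in
    [seq x.1.1 | x <- take k.+1 s] :: chop fuel' (~~ phase) (drop k.+1 s)
  end.

(* [:: A_1; D_1; A_2; D_2; ...; A_n] *)
Definition blocks (x0 : T) (C : seq T) : seq (seq T) :=
  chop (size C) true (flagged x0 C).

Section Star.
Variables (x0 : T) (C : seq T).
Let bl := blocks x0 C.
(* 0-based: Ablk i = A_{i+1}, Dblk i = D_{i+1} *)
Definition Ablk (i : nat) : seq T := nth [::] bl (i.*2).
Definition Dblk (i : nat) : seq T := nth [::] bl (i.*2).+1.
Definition nA : nat := uphalf (size bl).
Definition tA (i : nat) : T := last x0 (Ablk i).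

Definition star_cond : Prop :=
  forall i, i.+1 < nA ->
    (forall y, y \in Dblk i ->
       ~ ( (exists m, m < i /\ le y (tA m))
         \/ (exists a, a \in Ablk i /\ a != tA i /\ le y a)
         \/ y = tA i ))
    /\ (forall y, y \in Ablk i.+1 -> forall m, m <= i -> ~ le y (tA m)).
End Star.

Definition good_path (C : seq T) : Prop :=
  match C with
  | [::] => False
  | x0 :: _ => is_maximal_path x0 C /\ star_cond x0 C
  end.

Definition len_star_of (C : seq T) : nat :=
  match C with [::] => 0 | x0 :: _ => len_star x0 C end.

Definition lower_rank_is (r : nat) : Prop :=
  (exists C, good_path C /\ len_star_of C = r) /\
  (forall C, good_path C -> r <= len_star_of C).
End PosetPaths.

(* P-bar = P u {-oo, +oo}: None = -oo, Some None = +oo, Some (Some x) = x    *)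
Definition Pbar_le (d : Order.disp_t) (P : finPOrderType d)
  (a b : option (option P)) : bool :=
  match a, b with
  | None, _ => true
  | _, Some None => true
  | Some (Some x), Some (Some y) => (x <= y)%O
  | _, _ => false
  end.

Definition P_le (d : Order.disp_t) (P : finPOrderType d) (a b : P) : bool :=
  (a <= b)%O.

(* variable 0 is T, variable (lift ord0 (enum_rank p)) is X_p                *)
Section Hibi.
Variables (k : fieldType) (d : Order.disp_t) (P : finPOrderType d).

Local Open Scope ring_scope.
Local Notation n := #|P|.
Local Notation poly := {mpoly k[n.+1]}.

Definition is_poset_ideal (I : {set P}) : Prop :=
  forall x y : P, y \in I -> (x <= y)%O -> x \in I.

Definition varX (x : P) : poly := 'X_(lift ord0 (enum_rank x)).

Definition hibi_gen (I : {set P}) : poly :=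
  'X_ord0 * \prod_(x in I) varX x.

Definition inR (f : poly) : Prop :=
  exists l : seq (k * seq {set P}),
    (forall cs, cs \in l -> forall I, I \in cs.2 -> is_poset_ideal I) /\
    f = \sum_(cs <- l) cs.1 *: \prod_(I <- cs.2) hibi_gen I.

(* m = R_+ : elements of R whose homogeneous component of degree 0 vanishes
   (grading: each generator has degree 1, i.e. degree = exponent of T) *)
Definition inM (f : poly) : Prop :=
  inR f /\ forall m, m \in msupp f -> (0 < m ord0)%N.

Definition inMpow (a : nat) (f : poly) : Prop :=
  exists l : seq (poly * seq poly),
    (forall rx, rx \in l ->
       inR rx.1 /\ size rx.2 = a /\ forall x, x \in rx.2 -> inM x) /\
    f = \sum_(rx <- l) rx.1 * \prod_(x <- rx.2) x.

(* The R-linear map R -> R^{1/q}, 1 |-> f^{1/q} splits.  R^{1/q} is identified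
   with F^e_* R (the ring R with R-action r . s = r^q s, via s^{1/q} <-> s);
   a splitting is an R-linear phi : F^e_* R -> R with phi(f) = 1. *)
Definition splits_at (q : nat) (f : poly) : Prop :=
  exists phi : poly -> poly,
    [/\ forall x, inR x -> inR (phi x),
        forall x y, inR x -> inR y -> phi (x + y) = phi x + phi y,
        forall r x, inR r -> inR x -> phi (r ^+ q * x) = r * phi x
      & phi f = 1].

Definition Fpure_pair (p : nat) (t : R) : Prop :=
  exists e0 : nat, forall e : nat, (e0 <= e)%N ->
    exists a : nat,
      Rlt (Rminus (INR a) R1) (Rmult t (Rminus (INR (expn p e)) R1)) /\
      Rle (Rmult t (Rminus (INR (expn p e)) R1)) (INR a) /\
      exists f : poly, inMpow a f /\ splits_at (expn p e) f.

Definition fpt_is (p : nat) (c : R) : Prop :=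
  is_lub (fun t => Rle R0 t /\ Fpure_pair p t) c.
End Hibi.

(* Main.v *)
(* Monomials of the Hibi ring are the order-reversing functions on P-bar that
   vanish at +oo, the value at -oo being the degree, and m^a is spanned by those
   of degree at least a. A monomial splits off at q exactly when it drops by at
   most q - 1 along every cover relation, so fpt(m) is the largest value at -oo
   of a function vanishing at +oo whose drop along each cover lies in [0, 1].
   Linear programming duality, realised by the distance to +oo, turns this into
   the least number of up-steps of a walk in the Hasse diagram from -oo to +oo.
   A shortest optimal walk satisfies condition (star): if y <= x with y visited
   after x, then descending directly from x to y would save every up-step in
   between. *)

Require Import Defs.
From Stdlib Require Import Reals Lra Classical.
From HB Require Import structures.
From mathcomp Require Import all_boot all_order all_algebra.
From mathcomp Require Import mpoly zify.

Set Implicit Arguments.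
Unset Strict Implicit.
Unset Printing Implicit Defensive.

Import Order.TTheory GRing.Theory.

Lemma ex_least (Q : nat -> Prop) :
  (exists n, Q n) -> exists2 n, Q n & forall m, Q m -> n <= m.
Proof.
case=> n; elim/ltn_ind: n => n IHn Qn.
case: (classic (exists2 m, m < n & Q m)) => [[m lt_mn Qm]|noQ]; first exact: IHn Qm.
by exists n => // m Qm; rewrite leqNgt; apply/negP=> lt_mn; apply: noQ; exists m.
Qed.

(** * Walks in the Hasse diagram *)

Section Walks.
Variables (T : finType) (le : rel T).
Hypotheses (le_refl : reflexive le) (le_anti : antisymmetric le)
  (le_trans : transitive le).

Local Notation lt := (plt le).
Local Notation cov := (pcov le).

Lemma plt_le a b : lt a b -> le a b. Proof. by case/andP. Qed.

Lemma plt_le_trans b a c : lt a b -> le b c -> lt a c.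
Proof.
case/andP=> le_ab ne_ab le_bc; rewrite /plt (le_trans le_ab le_bc).
by apply: contra ne_ab => /eqP eq_ac; apply/eqP/le_anti; rewrite le_ab eq_ac.
Qed.

Lemma le_plt_trans b a c : le a b -> lt b c -> lt a c.
Proof.
move=> le_ab /andP[le_bc ne_bc]; rewrite /plt (le_trans le_ab le_bc).
by apply: contra ne_bc => /eqP eq_ac; apply/eqP/le_anti; rewrite le_bc -eq_ac.
Qed.

Lemma pltxx a : lt a a = false. Proof. by rewrite /plt eqxx andbF. Qed.

Lemma pcov_plt a b : cov a b -> lt a b. Proof. by case/andP. Qed.

Lemma pcov_asym a b : cov a b -> cov b a = false.
Proof.
move=> /pcov_plt ab; apply/negP=> /pcov_plt/plt_le ba.
by have := plt_le_trans ab ba; rewrite pltxx.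
Qed.

(** Induction on the number of elements strictly between [a] and [b]. If [b] does not cover [a], an
    intermediate [z] splits the interval into two intervals that omit [z] and are therefore
    smaller. *)
Lemma plt_ind (Q : T -> T -> Prop) :
    (forall a b, cov a b -> Q a b) ->
    (forall b a c, Q a b -> Q b c -> Q a c) ->
  forall a b, lt a b -> Q a b.
Proof.
move=> Qcov Qtrans a b; pose I x y := [set z | lt x z & lt z y].
move: {2}#|I a b| (leqnn #|I a b|) => n; elim: n a b => [|n IHn] a b leIn lt_ab;
  case: (boolP (cov a b)) => [/Qcov //|]; rewrite /pcov lt_ab negbK;
  case/existsP=> z /andP[az zb].
  by move: leIn; rewrite leqn0 cards_eq0 => /eqP/setP/(_ z); rewrite !inE az zb.
have zI : z \in I a b by rewrite inE az zb.
have leI (A : {set T}) : A \subset I a b -> z \notin A -> #|A| <= n.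
  move=> sA zA; rewrite -ltnS; apply: leq_trans leIn; apply: proper_card.
  by apply/properP; split=> //; exists z.
apply: (Qtrans z); apply: IHn => //; apply: leI; rewrite ?inE ?pltxx ?andbF //.
  apply/subsetP=> y; rewrite !inE => /andP[-> yz].
  exact: plt_le_trans yz (plt_le zb).
apply/subsetP=> y; rewrite !inE => /andP[zy ->]; rewrite andbT.
exact: plt_le_trans az (plt_le zy).
Qed.

Lemma ple_ind (Q : T -> T -> Prop) :
    (forall a b, cov a b -> Q a b) -> (forall a, Q a a) ->
    (forall b a c, Q a b -> Q b c -> Q a c) ->
  forall a b, le a b -> Q a b.
Proof.
move=> Qcov Qrefl Qtrans a b le_ab; have [->//|ne_ab] := eqVneq a b.
by apply: plt_ind => //; rewrite /plt le_ab.
Qed.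

Definition hasse (a b : T) := cov a b || cov b a.

Fixpoint ups (x : T) (s : seq T) : nat :=
  if s is y :: s' then cov x y + ups y s' else 0.

Lemma ups_cat x s1 s2 : ups x (s1 ++ s2) = ups x s1 + ups (last x s1) s2.
Proof. by elim: s1 x => //= y s1 IHs x; rewrite IHs addnA. Qed.

Lemma ascent a b : le a b -> exists2 s, path hasse a s & last a s = b.
Proof.
move: a b; apply: ple_ind => [a b cab|a|b a c [s1 p1 l1] [s2 p2 l2]].
- by exists [:: b]; rewrite //= /hasse cab.
- by exists [::].
- by exists (s1 ++ s2); rewrite ?cat_path ?last_cat l1 ?p1.
Qed.

Lemma descent a b : le b a ->
  exists s, [/\ path hasse a s, last a s = b & ups a s = 0].
Proof.
move: b a; apply: ple_ind => [b a cba|a|b c a [s1 [p1 l1 u1]] [s2 [p2 l2 u2]]].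
- by exists [:: b]; rewrite /= /hasse cba orbT (pcov_asym cba).
- by exists [::].
- exists (s2 ++ s1); rewrite cat_path last_cat ups_cat l2 p2 u2 p1; split=> //.
Qed.

(** Weak duality: a step up lowers [f] by at most [c] and a step down never lowers it, so only
    up-steps contribute to the bound. *)
Lemma leq_ups (f : T -> nat) c :
    (forall a b, cov a b -> f a <= f b + c /\ f b <= f a) ->
  forall x s, path hasse x s -> f x <= f (last x s) + c * ups x s.
Proof.
move=> fcov x s; elim: s x => [|y s IHs] x /=; first by rewrite leq_addr.
case/andP=> hxy /IHs le_y; case/orP: hxy => cxy; last rewrite (pcov_asym cxy);
  have [] := fcov _ _ cxy; rewrite ?cxy; lia.
Qed.

(** Vertices may repeat and condition (star) is not imposed; [least_walk] shows that this relaxation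
    leaves the minimal number of up-steps unchanged. *)
Definition min_max_walk x s :=
  [/\ pminimal le x, path hasse x s & pmaximal le (last x s)].

Lemma minimalP x : reflect (forall y, le y x -> y = x) (pminimal le x).
Proof.
apply: (iffP idP) => [/existsPn minx y le_yx|minx].
  by apply/eqP; have := minx y; rewrite /plt le_yx negbK.
by apply/existsPn=> y; rewrite /plt; apply/negP=> /andP[/minx->]; rewrite eqxx.
Qed.

Lemma maximalP x : reflect (forall y, le x y -> y = x) (pmaximal le x).
Proof.
apply: (iffP idP) => [/existsPn maxx y le_xy|maxx].
  by apply/esym/eqP; have := maxx y; rewrite /plt le_xy negbK.
by apply/existsPn=> y; rewrite /plt; apply/negP=> /andP[/maxx->]; rewrite eqxx.
Qed.

Lemma pmaximal_above x : exists2 y, le x y & pmaximal le y.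
Proof.
(* Among the elements above [x], one with the most elements below it is maximal. *)
have [y le_xy ymax] :=
  @arg_maxnP T x (le x) (fun y => #|[set z | le z y]|) (le_refl x).
exists y => //; apply/existsPn=> z; apply/negP=> yz.
have := ymax z (le_trans le_xy (plt_le yz)); apply/negP; rewrite -ltnNge.
apply: proper_card; apply/properP; split; last exists z; rewrite ?inE ?le_refl //.
  by apply/subsetP=> w; rewrite !inE => /le_trans; apply; apply: plt_le.
by apply/negP=> le_zy; have := plt_le_trans yz le_zy; rewrite pltxx.
Qed.

Lemma pminimal_below x : exists2 y, le y x & pminimal le y.
Proof.
have [y le_yx ymax] :=
  @arg_maxnP T x (le^~ x) (fun y => #|[set z | le y z]|) (le_refl x).
exists y => //; apply/existsPn=> z; apply/negP=> zy.
have := ymax z (le_trans (plt_le zy) le_yx); apply/negP; rewrite -ltnNge.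
apply: proper_card; apply/properP; split; last exists z; rewrite ?inE ?le_refl //.
  by apply/subsetP=> w; rewrite !inE; apply: le_trans; apply: plt_le.
by apply/negP=> le_yz; have := le_plt_trans le_yz zy; rewrite pltxx.
Qed.

Lemma min_max_walk_exists : 0 < #|T| -> exists x s, min_max_walk x s.
Proof.
case/card_gt0P=> z _; have [x le_xz minx] := pminimal_below z.
have [y le_zy maxy] := pmaximal_above z.
have [s ps ls] := ascent (le_trans le_xz le_zy).
by exists x, s; split; rewrite ?ls.
Qed.

(** * Comparison with indexed paths and their blocks *)

Section IndexedSteps.
Variable (x0 : T).

Lemma path_steps x s :
  path hasse x s = all (fun i => upstep le x0 (x :: s) i || downstep le x0 (x :: s) i)
                       (iota 0 (size s)).
Proof.
elim: s x => //= y s IHs x; rewrite IHs (iotaDl 1 0 (size s)) all_map.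
by congr (_ && _); apply: eq_all.
Qed.

Lemma ups_count x s : ups x s = count (upstep le x0 (x :: s)) (iota 0 (size s)).
Proof.
elim: s x => //= y s IHs x; rewrite IHs (iotaDl 1 0 (size s)) count_map.
by congr (_ + _); apply: eq_count.
Qed.

End IndexedSteps.

(** The requirement that the last step go up is automatic, since a maximal element has no upper
    cover from which to descend to it. *)
Lemma maximal_pathP x s :
  reflect (min_max_walk x s /\ uniq (x :: s)) (is_maximal_path le x (x :: s)).
Proof.
rewrite /is_maximal_path /is_path /= -(path_steps x x s).
have -> : nth x (x :: s) (size s) = last x s.
  by rewrite -[size s]/(size (x :: s)).-1 nth_last.
apply: (iffP idP) => [/andP[/and4P[u m p _] M] //|[[m p M] /= u]].
rewrite u m p M !andbT /=; apply/implyP.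
case: (lastP s) p M => // s' z.
rewrite size_rcons last_rcons rcons_path => /andP[_ h] M _.
have -> : upstep le x (x :: rcons s' z) (size s').+1.-1 = cov (last x s') z.
  rewrite /upstep /= nth_rcons ltnn eqxx -rcons_cons nth_rcons /= ltnSn.
  by rewrite -[size s']/(size (x :: s')).-1 nth_last.
case/orP: h => // /pcov_plt/andP[le_zl].
by move/maximalP: M => M; case/eqP; apply/esym/M.
Qed.

(** The last clause concerns every block but the final one: its last entry, located by the total
    length of the blocks so far, carries the flag sought in its phase. *)
Lemma chop_spec fuel phase (s : seq (T * bool * bool)) : size s <= fuel ->
  [/\ flatten (chop fuel phase s) = [seq u.1.1 | u <- s],
      all (fun b => 0 < size b) (chop fuel phase s)
    & forall j u0, j.+1 < size (chop fuel phase s) ->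
      let u := nth u0 s (size (flatten (take j.+1 (chop fuel phase s)))).-1 in
      if phase (+) odd j then u.1.2 else u.2].
Proof.
elim: fuel phase s => [|fuel IHf] phase [|u s] //= le_s.
set k := (X in drop X s).
have [|eq_f ne_f end_f] := IHf (~~ phase) (drop k s).
  by rewrite -ltnS (leq_ltn_trans _ le_s) // size_drop leq_subr.
split=> [||j u0].
- by rewrite eq_f -map_cat cat_take_drop.
- exact: ne_f.
(* A further block exists only if the search stopped before the end of the sequence; otherwise the
   first block would exhaust it. *)
move=> lt_j; have lt_k : k < size s.
  rewrite ltnNge; apply/negP=> le_k; move: lt_j.
  by rewrite drop_oversize //; case: (fuel).
case: j lt_j => [|j] lt_j.
  rewrite /= take0 cats0 size_map size_takel 1?ltnW // addbF.
  have := @nth_find _ u0 (fun v => if phase then v.1.2 else v.2) (u :: s).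
  rewrite has_find /= => /(_ (ltnW lt_k)).
  by case: (phase).
have := end_f j u0 lt_j; rewrite /= size_cat size_map size_takel 1?ltnW //.
set M := size (flatten _).
have M_gt0 : 0 < M.
  rewrite /M; case: (chop _ _ _) ne_f lt_j => //= b bl /andP[b_gt0 _] _.
  by rewrite size_cat ltn_addr.
by rewrite nth_drop addbN addNb -(prednK M_gt0) addnS.
Qed.

(** * Condition (star) from the absence of shortcuts *)

Section Star.
Variables (x0 : T) (C : seq T).
Hypothesis C_uniq : uniq C.
Hypothesis no_shortcut : forall i j, i < j < size C ->
  le (nth x0 C j) (nth x0 C i) ->
  forall l, i <= l < j -> ~~ upstep le x0 C l.

Local Notation bl := (blocks le x0 C).
Local Notation off j := (size (flatten (take j bl))).

Lemma blocks_spec :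
  [/\ flatten bl = C, all (fun b => 0 < size b) bl
    & forall j, j.+1 < size bl ->
      if odd j then locmin le x0 C (off j.+1).-1 else locmax le x0 C (off j.+1).-1].
Proof.
have [|eq_bl ne_bl end_bl] := @chop_spec (size C) true (flagged le x0 C).
  by rewrite size_map size_iota.
have flat_bl : flatten bl = C.
  rewrite eq_bl -map_comp -[RHS](mkseq_nth x0); exact: eq_map.
split=> // j lt_j; have := end_bl j (x0, false, false) lt_j.
have lt_off : (off j.+1).-1 < size C.
  rewrite -{2}flat_bl -{2}(cat_take_drop j.+1 bl) flatten_cat size_cat.
  rewrite (drop_nth [::] lt_j) /= size_cat.
  have := allP ne_bl _ (mem_nth [::] lt_j) => /=; lia.
by rewrite /= (nth_map 0) ?size_iota // nth_iota // add0n if_neg.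
Qed.

Lemma off_succ j : j < size bl -> off j.+1 = off j + size (nth [::] bl j).
Proof.
by move=> lt_j; rewrite (take_nth [::] lt_j) -cats1 flatten_cat /= cats0 size_cat.
Qed.

Lemma off_lt j : j < size bl -> off j < off j.+1.
Proof.
have [_ ne_bl _] := blocks_spec => lt_j; rewrite off_succ // -addn1 leq_add2l.
exact: (allP ne_bl _ (mem_nth [::] lt_j)).
Qed.

Lemma off_leq i j : i <= j -> off i <= off j.
Proof.
move=> le_ij; rewrite -(cat_take_drop i (take j bl)) take_takel //.
by rewrite flatten_cat size_cat leq_addr.
Qed.

Lemma off_leq_size j : off j <= size C.
Proof.
have [flat _ _] := blocks_spec.
by rewrite -{2}flat -{2}(cat_take_drop j bl) flatten_cat size_cat leq_addr.
Qed.

Lemma nth_block j i : j < size bl -> i < size (nth [::] bl j) ->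
  nth x0 (nth [::] bl j) i = nth x0 C (off j + i).
Proof.
move=> lt_j lt_i; have [flat _ _] := blocks_spec.
rewrite -{2}flat -{2}(cat_take_drop j bl) (drop_nth [::] lt_j) flatten_cat /=.
by rewrite !nth_cat ltnNge leq_addr /= addKn lt_i.
Qed.

Lemma mem_block j y : j < size bl -> y \in nth [::] bl j ->
  exists2 i, off j <= i < off j.+1 & y = nth x0 C i.
Proof.
move=> lt_j /(nthP x0)[i lt_i <-]; exists (off j + i).
  by rewrite leq_addr off_succ // ltn_add2l.
exact: nth_block.
Qed.

Lemma last_block j : j < size bl ->
  last x0 (nth [::] bl j) = nth x0 C (off j.+1).-1.
Proof.
move=> lt_j; have := off_lt lt_j; rewrite (off_succ lt_j) => lt_off.
rewrite -nth_last nth_block //; first by congr (nth x0 C _); lia.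
by rewrite prednK //; lia.
Qed.

Lemma upstep_after_D j : j.*2.+2 < size bl -> upstep le x0 C (off j.*2.+2).-1.
Proof.
move=> lt_j; have [_ _ /(_ _ lt_j)] := blocks_spec.
rewrite /= odd_double /= => /orP[/eqP eq0|/and4P[]//].
have := off_lt (ltnW (ltnW lt_j)); have := off_lt (ltnW lt_j); lia.
Qed.

Lemma upstep_before_top j : j.*2.+1 < size bl -> off j.*2 < (off j.*2.+1).-1 ->
  upstep le x0 C (off j.*2.+1).-2.
Proof.
move=> lt_j lt_off; have [_ _ /(_ _ lt_j)] := blocks_spec.
rewrite odd_double /= => /orP[/eqP eqC|/and4P[]//].
have := off_lt lt_j; have := off_leq_size j.*2.+2; lia.
Qed.

(** A violation of (star) by an inequality puts a later vertex below an earlier one with an up-step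
    in between. If the earlier vertex is the top of an A-block and the later one lies beyond the
    next D-block, this is the up-step leaving that D-block. If the earlier one is a non-top vertex
    of the A-block just before, it is the up-step reaching the top. The remaining case, a D-block
    containing the preceding top, contradicts distinctness. *)
Lemma no_shortcut_star : star_cond le x0 C.
Proof.
move=> i; rewrite /nA => lt_i.
have {}lt_i : i.*2.+2 < size bl by lia.
have lt_i1 := ltnW lt_i; have lt_i0 := ltnW lt_i1.
have tAE m : m <= i -> tA le x0 C m = nth x0 C (off m.*2.+1).-1.
  by move=> le_mi; rewrite /tA /Ablk last_block //; lia.
have above m y : m <= i -> forall b, off m.*2.+2 <= b < size C ->
    y = nth x0 C b -> ~ le y (tA le x0 C m).
  move=> le_mi b /andP[lt_b lt_bC] -> le_y.
  have lt_m : m.*2.+2 < size bl by lia.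
  have := upstep_after_D lt_m; apply/negP.
  have off1 := off_lt (ltnW (ltnW lt_m)); have off2 := off_lt (ltnW lt_m).
  move: le_y; rewrite (tAE m le_mi) => /(no_shortcut _); apply; lia.
split=> y.
  move=> /(mem_block lt_i1)[b /andP[le_b lt_b] def_y].
  have lt_bC : b < size C := leq_trans lt_b (off_leq_size _).
  case=> [[m [lt_mi]]|[[a [Aa [ne_a le_ya]]]|]].
  - apply: (above m y (ltnW lt_mi) b) => //.
    by rewrite lt_bC andbT (leq_trans _ le_b) // off_leq //; lia.
  - have [c /andP[le_c lt_c] def_a] := mem_block lt_i0 Aa.
    have {}lt_c : c < (off i.*2.+1).-1.
      rewrite ltn_neqAle -ltnS prednK ?lt_c ?andbT; last lia.
      by apply: contra ne_a => /eqP eq_c; rewrite def_a eq_c tAE.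
    have := upstep_before_top lt_i1 (leq_ltn_trans le_c lt_c); apply/negP.
    move: le_ya; rewrite def_y def_a => /(no_shortcut _); apply; lia.
  - have := off_lt lt_i0 => lt_off; rewrite def_y tAE // => /eqP.
    rewrite nth_uniq //; [move=> /eqP; lia|].
    exact: leq_ltn_trans (leq_trans (leq_pred _) le_b) lt_bC.
move=> Ay m le_mi; have [b /andP[le_b lt_b] def_y] := mem_block lt_i Ay.
apply: (above m y le_mi b) => //.
rewrite (leq_trans lt_b (off_leq_size _)) andbT (leq_trans _ le_b) // off_leq //; lia.
Qed.

End Star.

(** * Shortening walks and optimal walks *)

Lemma last_take (x : T) s i : i <= size s -> last x (take i s) = nth x (x :: s) i.
Proof.
elim: s i x => [|y s IHs] [|i] x //= le_i.
by rewrite IHs //; apply: set_nth_default; rewrite /= ltnS.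
Qed.

Lemma ups_take x s j : j <= size s ->
  ups x (take j s) = count (upstep le x (x :: s)) (iota 0 j).
Proof.
move=> le_j; rewrite (ups_count x) size_takel //.
apply: eq_in_count => i; rewrite mem_iota add0n => /andP[_ lt_ij].
by rewrite /upstep -[x :: take j s]/(take j.+1 (x :: s)) !nth_take // ltnW.
Qed.

(** The stretch from position [i] to position [j] is replaced by a descent [d], which costs no
    up-step, so exactly the up-steps of the stretch are saved. The last clause makes the detour
    empty when the two vertices coincide, so that removing a loop also shortens the walk. *)
Lemma cut_walk x s i j : i <= j -> min_max_walk x s -> j <= size s ->
    le (nth x (x :: s) j) (nth x (x :: s) i) ->
  exists d, [/\ min_max_walk x (take i s ++ d ++ drop j s),
      ups x s = ups x (take i s ++ d ++ drop j s)
                + count (upstep le x (x :: s)) (iota i (j - i))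
    & nth x (x :: s) j = nth x (x :: s) i -> d = [::]].
Proof.
move=> le_ij [minx ps maxs] le_js le_ji.
have le_is := leq_trans le_ij le_js.
have [d [pd ld [ud nild]]] : exists d, [/\ path hasse (nth x (x :: s) i) d,
   last (nth x (x :: s) i) d = nth x (x :: s) j & ups (nth x (x :: s) i) d = 0 /\
   (nth x (x :: s) j = nth x (x :: s) i -> d = [::])].
  have [eq_ji|/eqP ne_ji] := eqVneq (nth x (x :: s) j) (nth x (x :: s) i).
    by exists [::]; rewrite eq_ji.
  by have [d [pd ld ud]] := descent le_ji; exists d.
exists d.
move: (ps) (maxs); rewrite -{1 2}(cat_take_drop j s) cat_path last_cat last_take //.
case/andP=> pj pjs max_js; move: (ps).
rewrite -{1}(cat_take_drop i s) cat_path => /andP[pi _].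
split=> //; first split=> //.
- by rewrite !cat_path last_take // pi pd ld.
- by rewrite !last_cat last_take // ld.
rewrite !ups_cat last_take // ld ud add0n -{1}(cat_take_drop j s) ups_cat last_take //.
rewrite !ups_take // addnAC -count_cat; congr (count _ _ + _).
by rewrite -{2}[i]add0n -iotaD subnKC.
Qed.

(** The walk minimises first the number of up-steps, then the length. A repeated vertex would
    contradict the second choice, and a descent bypassing an up-step the first; hence the walk is a
    path satisfying (star). *)
Lemma least_walk : 0 < #|T| -> exists r : nat,
  [/\ exists C, good_path le C /\ len_star_of le C = r,
      forall x s, min_max_walk x s -> r <= ups x s
    & exists x s, [/\ min_max_walk x s, uniq (x :: s) & ups x s = r]].
Proof.
move=> T_gt0; have [x1 [s1 walk1]] := min_max_walk_exists T_gt0.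
have [|r [x2 [s2 [walk2 ups2]]] rmin] :=
  @ex_least (fun r => exists x s, min_max_walk x s /\ ups x s = r).
  by exists (ups x1 s1), x1, s1.
have {}rmin x s : min_max_walk x s -> r <= ups x s by move=> w; apply: rmin; exists x, s.
have [|n [x [s [walk ups_s size_s]]] nmin] := @ex_least (fun n =>
    exists x s, [/\ min_max_walk x s, ups x s = r & size s = n]).
  by exists (size s2), x2, s2.
have xs_uniq : uniq (x :: s).
  apply: contraT => /(uniqPn x)[i [j [lt_ij lt_j eq_ij]]].
  have [|d [w u /(_ (esym eq_ij)) d0]] := cut_walk (ltnW lt_ij) walk lt_j.
    by rewrite eq_ij.
  have := rmin _ _ w; move: w u; rewrite d0 /= => w u le_r.
  have /nmin : exists x s', [/\ min_max_walk x s', ups x s' = r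
      & size s' = size (take i s ++ drop j s)].
    by exists x, (take i s ++ drop j s); split=> //; lia.
  rewrite size_cat size_drop -size_s size_takel; move: lt_j lt_ij; rewrite /=; lia.
exists r; split=> //; last by exists x, s.
exists (x :: s); split; last by rewrite /= /len_star -ups_count.
split; first exact/maximal_pathP.
apply: no_shortcut_star => // i j /andP[lt_ij lt_j] le_ji l /andP[le_il lt_lj].
have [d [w u _]] := cut_walk (ltnW lt_ij) walk lt_j le_ji.
have := rmin _ _ w => le_r; apply/negP=> ul.
have : 0 < count (upstep le x (x :: s)) (iota i (j - i)).
  by rewrite -has_count; apply/hasP; exists l; rewrite // mem_iota; lia.
by lia.
Qed.

Lemma lower_rank_is_least r :
    (exists C, good_path le C /\ len_star_of le C = r) ->
    (forall x s, min_max_walk x s -> r <= ups x s) ->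
  lower_rank_is le r.
Proof.
move=> ex_r le_r; split=> // -[//|x s] [/maximal_pathP[w _] _].
by rewrite /= /len_star -ups_count; apply: le_r.
Qed.

End Walks.

(** * Roots in a perfect field *)

Section PerfectField.
Local Open Scope ring_scope.

Lemma exprD_pchar_pow (A : comNzRingType) p e (x y : A) : p \in [pchar A] ->
  (x + y) ^+ (p ^ e)%N = x ^+ (p ^ e)%N + y ^+ (p ^ e)%N.
Proof.
by move=> pA; apply: exprDn_pchar; rewrite pnatX pnatE ?pA ?(pcharf_prime pA).
Qed.

Variables (k : fieldType) (p : nat).
Hypotheses (p_prime : prime p) (p_char : p \in [pchar k])
  (k_perfect : forall x : k, exists y, y ^+ p = x).
Variable e : nat.
Local Notation q := (p ^ e)%N.

Lemma root_exists x : exists y : k, y ^+ q = x.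
Proof.
elim: e x => [|e' IHe] x; first by exists x.
have [y yx] := k_perfect x; have [z zy] := IHe y.
by exists z; rewrite expnS mulnC exprM zy.
Qed.

Lemma pow_inj (x y : k) : x ^+ q = y ^+ q -> x = y.
Proof.
move=> eq_xy; apply/eqP; have q_gt0 : (0 < q)%N by rewrite expn_gt0 prime_gt0.
rewrite -subr_eq0 -[_ == 0]andTb -q_gt0 -expf_eq0.
have := exprD_pchar_pow e (x - y) y p_char; rewrite subrK eq_xy.
by move/eqP; rewrite -subr_eq addrN eq_sym.
Qed.

(** The inverse of the iterated Frobenius of [k]. Each identity may be checked after taking [q]-th
    powers, which are injective. *)
Lemma root_semilinear : exists rt : k -> k,
  [/\ rt 1 = 1, {morph rt : x y / x + y} & forall c x, rt (c ^+ q * x) = c * rt x].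
Proof.
have ex_rt x : exists y : k, y ^+ q == x by have [y <-] := root_exists x; exists y.
have rtK x : xchoose (ex_rt x) ^+ q = x := eqP (xchooseP (ex_rt x)).
exists (fun x => xchoose (ex_rt x)); split=> [|x y|c x]; apply: pow_inj.
- by rewrite rtK expr1n.
- by rewrite exprD_pchar_pow // !rtK.
- by rewrite exprMn !rtK.
Qed.

End PerfectField.

(** * The bounded extension of the poset *)

Section Bar.
Variables (d : Order.disp_t) (P : finPOrderType d).

Local Notation bar := (option (option P)).
Local Notation ble := (@Pbar_le d P).
Local Notation ple := (@P_le d P).
Local Notation bot := (None : bar).
Local Notation top := (Some None : bar).
Local Notation emb x := (Some (Some x) : bar).

Lemma P_le_refl : reflexive ple. Proof. exact: lexx. Qed.
Lemma P_le_anti : antisymmetric ple. Proof. exact: le_anti. Qed.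
Lemma P_le_trans : transitive ple. Proof. exact: le_trans. Qed.

Lemma Pbar_le_refl : reflexive ble.
Proof. by case=> [[x|]|] //=. Qed.
Lemma Pbar_le_anti : antisymmetric ble.
Proof. by case=> [[x|]|] [[y|]|] //= /le_anti->. Qed.
Lemma Pbar_le_trans : transitive ble.
Proof. by case=> [[x|]|] [[y|]|] [[z|]|] //=; apply: le_trans. Qed.
Lemma Pbar_le_top a : ble a top.
Proof. by case: a => [[]|]. Qed.

Lemma plt_emb x y : plt ble (emb x) (emb y) = plt ple x y.
Proof. by []. Qed.

Lemma pcov_emb x y : pcov ble (emb x) (emb y) = pcov ple x y.
Proof.
rewrite /pcov plt_emb; congr (_ && ~~ _).
apply/existsP/existsP => [[[[z|]|]]|[z]] //; last by exists (emb z).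
by rewrite !plt_emb; exists z.
Qed.

Lemma pcov_bot_emb x : pcov ble bot (emb x) = pminimal ple x.
Proof.
rewrite /pcov /pminimal; congr (~~ _).
apply/existsP/existsP => [[[[z|]|]]|[z]] //; last by exists (emb z).
by rewrite plt_emb; exists z.
Qed.

Lemma pcov_emb_top x : pcov ble (emb x) top = pmaximal ple x.
Proof.
rewrite /pcov /pmaximal; congr (~~ _).
apply/existsP/existsP => [[[[z|]|]]|[z]] //.
  by rewrite plt_emb andbT; exists z.
by move=> xz; exists (emb z); rewrite plt_emb xz.
Qed.

Lemma pcov_bot a : pcov ble a bot = false.
Proof. by case: a => [[]|]. Qed.

Lemma pcov_top a : pcov ble top a = false.
Proof. by case: a => [[]|]. Qed.

Lemma pminimal_bar a : pminimal ble a = (a == bot).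
Proof.
apply/(minimalP ble)/eqP => [/(_ bot isT)//|->].
by case=> [[]|].
Qed.

Lemma pmaximal_bar a : pmaximal ble a = (a == top).
Proof.
apply/(maximalP ble)/eqP => [/(_ top (Pbar_le_top a))//|->].
by case=> [[]|].
Qed.

Lemma path_emb x s :
  path (hasse ble) (emb x) (map (fun y => emb y) s) = path (hasse ple) x s.
Proof. by rewrite path_map; apply: eq_path => y z; rewrite /= /hasse !pcov_emb. Qed.

Lemma ups_emb x s : ups ble (emb x) (map (fun y => emb y) s) = ups ple x s.
Proof. by elim: s x => //= y s IHs x; rewrite IHs pcov_emb. Qed.

Lemma bar_walk x s : min_max_walk ple x s ->
  exists s', min_max_walk ble bot s' /\ ups ble bot s' = ups ple x s + 2.
Proof.
case=> minx ps maxs; exists (emb x :: rcons (map (fun y => emb y) s) top).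
rewrite /min_max_walk pminimal_bar /= pmaximal_bar rcons_path -cats1 ups_cat.
rewrite path_emb ups_emb ps (last_map (fun y => emb y)) /hasse /= pcov_bot_emb minx.
by rewrite last_cat pcov_emb_top maxs; split=> //; lia.
Qed.

(** Distinctness confines both added points to the ends of the walk. Its interior is then a walk in
    [P], and one up-step is lost at each end. *)
Lemma bar_uniq_walk a s : 0 < #|P| -> min_max_walk ble a s -> uniq (a :: s) ->
  exists x s', min_max_walk ple x s' /\ ups ple x s' + 2 = ups ble a s.
Proof.
move=> /card_gt0P[x0 _] []; rewrite pminimal_bar pmaximal_bar => /eqP->.
case: (lastP s) => // {}s b; rewrite rcons_path last_rcons => /andP[ps hb] /eqP eq_b.
rewrite {b}eq_b in hb *.
rewrite /= mem_rcons in_cons rcons_uniq /= => /and3P[bot_s top_s _].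
have [t def_s] : exists t, s = map (fun y => emb y) t.
  exists (pmap (fun a : bar => if a is Some b then b else None) s).
  elim: s bot_s top_s {ps hb} => //= -[[x|]|] s IHs; rewrite !in_cons //=.
  by move=> bs ts; rewrite -IHs.
move: ps hb; rewrite def_s -cats1 ups_cat; clear s def_s bot_s top_s.
case: t => [|x t] /=.
  (* The interior is not empty: an element of [P] lies strictly between the two added points. *)
  by rewrite /hasse pcov_top orbF => _ /andP[_ /existsPn/(_ (emb x0))].
rewrite path_emb ups_emb (last_map (fun y => emb y)) /hasse pcov_bot pcov_top !orbF.
rewrite pcov_bot_emb pcov_emb_top => /andP[minx pt] maxt.
by exists x, t; split=> //; rewrite minx maxt; lia.
Qed.

Lemma lower_rank_bar : 0 < #|P| -> exists r, 
  [/\ lower_rank_is ple r, lower_rank_is ble (r + 2),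
      forall s, min_max_walk ble bot s -> r + 2 <= ups ble bot s
    & exists s, min_max_walk ble bot s /\ ups ble bot s = r + 2].
Proof.
move=> P_gt0.
have [r [goodP minP [x [s [walkP _ upsP]]]]] :=
  least_walk P_le_refl P_le_anti P_le_trans P_gt0.
have bar_gt0 : 0 < #|{: bar}| by apply/card_gt0P; exists bot.
have [r' [goodB minB [a [t [walkB uniqB upsB]]]]] :=
  least_walk Pbar_le_refl Pbar_le_anti Pbar_le_trans bar_gt0.
have [y [t' [walkP' upsP']]] := bar_uniq_walk P_gt0 walkB uniqB.
have [s' [walkB' upsB']] := bar_walk walkP.
have eq_r : r' = r + 2.
  by have := minP _ _ walkP'; have := minB _ _ walkB'; lia.
rewrite eq_r in minB goodB; exists r; split.
- exact: lower_rank_is_least.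
- exact: lower_rank_is_least.
- by move=> w; apply: minB.
- by exists s'; rewrite upsB' upsP.
Qed.

(** Strong duality: [dist a] is the least number of up-steps of a walk from [a] to the top. For [b]
    covering [a], the step from [a] to [b] costs one and the step back is free, whence the two
    inequalities. *)
Lemma bar_potential N :
    (forall s, min_max_walk ble bot s -> N <= ups ble bot s) ->
    (exists s, min_max_walk ble bot s /\ ups ble bot s = N) ->
  exists dist : bar -> nat, [/\ dist top = 0, dist bot = N
    & forall a b, pcov ble a b -> dist a <= dist b + 1 /\ dist b <= dist a].
Proof.
move=> minN [s0 [walk0 ups0]].
pose Q a n := exists s, [/\ path (hasse ble) a s, last a s = top & ups ble a s = n].
have [dist distP] : exists dist : bar -> nat,
    forall a, Q a (dist a) /\ forall m, Q a m -> dist a <= m.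
  apply: (@fin_all_exists _ (fun=> nat)
    (fun a n => Q a n /\ forall m, Q a m -> n <= m)) => a.
  have [|n Qn minn] := @ex_least (Q a); last by exists n.
  have [s ps ls] := ascent Pbar_le_anti Pbar_le_trans (Pbar_le_top a).
  by exists (ups ble a s), s.
exists dist; split.
- by have [_ /(_ 0)] := distP top => le0; apply/eqP; rewrite -leqn0 le0 //; exists [::].
- have [[s [ps ls us]] le_dist] := distP bot; apply/eqP; rewrite eqn_leq.
  rewrite -{2}us minN ?andbT; last by split; rewrite ?pminimal_bar ?ls ?pmaximal_bar.
  case: walk0 => _ ps0; rewrite pmaximal_bar => /eqP ls0.
  by apply: le_dist; exists s0.
move=> a b cab; have [[s [ps ls us]] le_a] := distP a.
have [[t [pt lt ut]] le_b] := distP b.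
split.
  by apply: le_a; exists (b :: t); rewrite /= /hasse cab pt ut addnC.
apply: le_b; exists (a :: s); rewrite /= /hasse cab orbT ps us.
by rewrite (pcov_asym Pbar_le_anti Pbar_le_trans cab).
Qed.

(** * Monomials as order-reversing functions *)

Local Notation mon := 'X_{1..#|P|.+1}.

Definition expo (m : mon) (a : bar) : nat :=
  match a with
  | None => m ord0
  | Some None => 0
  | Some (Some x) => m (lift ord0 (enum_rank x))
  end.

Definition mon_of (h : bar -> nat) : mon :=
  [multinom (if unlift ord0 i is Some j then h (emb (enum_val j)) else h bot)
  | i < #|P|.+1].

Definition cone (m : mon) : bool :=
  [forall a, forall b, ble a b ==> (expo m b <= expo m a)].

Lemma coneP m : reflect (forall a b, ble a b -> expo m b <= expo m a) (cone m).
Proof.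
apply: (iffP forallP) => [mP a b|mP a]; first exact/implyP/(forallP (mP a)).
by apply/forallP=> b; apply/implyP/mP.
Qed.

Lemma expo_mon_of h : h top = 0 -> expo (mon_of h) =1 h.
Proof.
move=> h_top [[x|]|] /=; rewrite ?mnmE ?unlift_none //.
by rewrite liftK enum_rankK.
Qed.

Lemma expo_inj m1 m2 : expo m1 =1 expo m2 -> m1 = m2.
Proof.
move=> eq_m; apply/mnmP=> i; case: (unliftP ord0 i) => [j ->|->].
  by have := eq_m (emb (enum_val j)); rewrite /= enum_valK.
exact: (eq_m bot).
Qed.

Lemma expoD m1 m2 a : expo (m1 + m2)%MM a = expo m1 a + expo m2 a.
Proof. by case: a => [[x|]|] //=; rewrite mnmDE. Qed.

Lemma expoMn m q a : expo (m *+ q)%MM a = expo m a * q.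
Proof. by case: a => [[x|]|] //=; rewrite mulmnE. Qed.

Lemma expo0 a : expo 0%MM a = 0.
Proof. by case: a => [[x|]|] //=; rewrite mnm0E. Qed.

Lemma expo_sum (I : Type) (r : seq I) (F : I -> mon) a :
  expo (\sum_(i <- r) F i)%MM a = \sum_(i <- r) expo (F i) a.
Proof. by rewrite (big_morph (expo^~ a) (fun m1 m2 => expoD m1 m2 a) (expo0 a)). Qed.

Lemma cone0 : cone 0%MM.
Proof. by apply/coneP=> a b _; rewrite !expo0. Qed.

Lemma coneD m1 m2 : cone m1 -> cone m2 -> cone (m1 + m2)%MM.
Proof.
by move=> /coneP m1P /coneP m2P; apply/coneP=> a b ab; rewrite !expoD leq_add ?m1P ?m2P.
Qed.

(** Here [w] is the indicator of the elements below [x], and [s] adds the indicators of those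
    strictly below [x] and of those below [y]; the latter is omitted when [y] is the top, where
    exponents vanish. Thus [m'], which is [m + Q (s - w)], adds [Q] to [m] on the elements below [y]
    (if [y] is not the top) and subtracts [Q] at [x] alone. The gap leaves room for this
    subtraction. *)
Lemma gap_exchange x y m Q : pcov ble x y -> cone m -> expo m y + Q <= expo m x ->
  exists s w m', [/\ [/\ cone s, cone w & cone m'], (s *+ Q + m = w *+ Q + m')%MM
    & [/\ expo s x = expo s y, expo w x = 1 & expo w y = 0]].
Proof.
move=> cxy mP gap; have lt_xy := pcov_plt cxy; have le_xy := plt_le lt_xy.
have trans := Pbar_le_trans; have refl := Pbar_le_refl; have anti := Pbar_le_anti.
have nyx : ble y x = false.
  by apply/negP=> yx; have := plt_le_trans anti trans lt_xy yx; rewrite pltxx.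
have ntop_x : ble top x = false.
  by apply/negP=> tx; move: nyx; rewrite (trans _ _ _ (Pbar_le_top y) tx).
pose w := mon_of (ble^~ x).
pose s := mon_of (fun z => plt ble z x + ((y != top) && ble z y)).
have wE z : expo w z = ble z x by rewrite expo_mon_of ?ntop_x.
have sE z : expo s z = plt ble z x + ((y != top) && ble z y).
  by rewrite expo_mon_of // /plt ntop_x; case: (y) => [[]|].
have le_wms z : expo w z * Q <= expo m z + expo s z * Q.
  rewrite wE sE; case le_zx: (ble z x) => //=; rewrite mul1n /plt le_zx /=.
  case: (eqVneq z x) => [->|_] /=; last by rewrite mulnDl mul1n addnCA leq_addr.
  exact/(leq_trans _ (leq_addr _ _))/(leq_trans _ gap)/leq_addl.
have plt_mono a b : ble a b -> plt ble b x <= plt ble a x.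
  by case pb: (plt ble b x) => // ab; rewrite (le_plt_trans anti trans ab pb).
have le_mono a b z : ble a b -> ble b z <= ble a z.
  by case bz: (ble b z) => // ab; rewrite (trans _ _ _ ab bz).
have s2_mono a b : ble a b -> ((y != top) && ble b y) <= ((y != top) && ble a y).
  by move=> ab; case: (y != top) => //=; apply: le_mono.
have wP : cone w by apply/coneP=> a b ab; rewrite !wE le_mono.
have sP : cone s by apply/coneP=> a b ab; rewrite !sE leq_add ?plt_mono ?s2_mono.
pose m' := mon_of (fun z => expo m z + expo s z * Q - expo w z * Q).
have m'E z : expo m' z = expo m z + expo s z * Q - expo w z * Q.
  by rewrite expo_mon_of.
exists s, w, m'; split; last first.
- by rewrite !sE !wE refl nyx pltxx refl le_xy /plt nyx.
- apply: expo_inj => z; rewrite !(expoD, expoMn) m'E.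
  by rewrite (subnKC (le_wms z)) addnC.
split=> //; apply/coneP=> a b ab; rewrite !m'E.
have s_ab := coneP _ sP a b ab; have m_ab := coneP _ mP a b ab.
have le_sQ : expo s b * Q <= expo s a * Q by rewrite leq_mul2r s_ab orbT.
case bx: (ble b x).
  by rewrite !wE bx (trans _ _ _ ab bx) leq_sub2r // leq_add.
rewrite !wE bx mul0n subn0.
case ax: (ble a x); last by rewrite mul0n subn0 leq_add.
rewrite mul1n; have nbx : plt ble b x = false by rewrite /plt bx.
(* For [a] strictly below [x] and [b] not below [x], the first summand of [s] drops by one and
   compensates the drop of [w]. *)
have [eq_ax|ne_ax] := eqVneq a x; last first.
  have : (expo s b).+1 * Q <= expo s a * Q.
    by rewrite leq_mul2r !sE nbx /plt ax ne_ax /= ltnS s2_mono ?orbT.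
  by move: m_ab; rewrite mulSn; clear; lia.
rewrite {}eq_ax in ab ax m_ab s_ab le_sQ *; case yb: (ble y b).
  by move: (coneP _ mP y b yb) gap le_sQ; clear; lia.
(* Now [b] is above [x] but not above [y]. As [y] covers [x], it is not below [y] either, so [s]
   vanishes at [b]. *)
have nby : ble b y = false.
  apply/negP=> by_; case/andP: cxy => _ /existsPn/(_ b)/negP[]; rewrite /plt ab by_ /=.
  by apply/andP; split; [apply: contraFneq bx|apply: contraFneq yb] => ->.
have s_b : expo s b = 0 by rewrite sE nbx nby andbF.
have s_x : expo s x = 1.
  by rewrite sE pltxx le_xy andbT; case: eqP nby => // ->; rewrite Pbar_le_top.
by rewrite s_b s_x mul0n mul1n addn0; move: m_ab; clear; lia.
Qed.

Definition ideal_mon (I : {set P}) : mon :=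
  mon_of (fun a => match a with None => 1 | Some None => 0
                   | Some (Some x) => x \in I end).

Lemma expo_ideal I a : expo (ideal_mon I) a =
  match a with None => 1 | Some None => 0 | Some (Some x) => x \in I end.
Proof. exact: expo_mon_of. Qed.

Lemma cone_ideal I : is_poset_ideal I -> cone (ideal_mon I).
Proof.
move=> idI; apply/coneP=> a b; rewrite !expo_ideal; case: a b => [[x|]|] [[y|]|] //=.
  by case Iy: (y \in I) => // le_xy; rewrite (idI _ _ Iy le_xy).
by case: (y \in I).
Qed.

(** Superlevel sets of the exponent function, as many as the degree. For [m] in the cone they form a
    descending chain of ideals whose generators multiply to the monomial. *)
Definition layers (m : mon) : seq {set P} :=
  [seq [set x : P | j < expo m (emb x)] | j <- iota 0 (m ord0)].

Lemma size_layers m : size (layers m) = m ord0.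
Proof. by rewrite size_map size_iota. Qed.

Lemma layers_ideal m : cone m -> forall I, I \in layers m -> is_poset_ideal I.
Proof.
move=> /coneP mP I /mapP[j _ ->] x y; rewrite !inE => lt_j le_xy.
exact: leq_trans lt_j (mP (emb x) (emb y) le_xy).
Qed.

Lemma count_lt_iota N c : c <= N -> \sum_(j <- iota 0 N) (j < c : nat) = c.
Proof.
move=> le_c; rewrite -(subnKC le_c) iotaD big_cat /=.
rewrite big_seq_cond (eq_bigr (fun=> 1)) => [|j]; last first.
  by rewrite mem_iota add0n andbT => /andP[_ ->].
rewrite -big_seq_cond sum1_size size_iota big_seq_cond big1 ?addn0 // => j.
by rewrite mem_iota add0n andbT => /andP[le_cj _]; rewrite ltnNge le_cj.
Qed.

Lemma sum_layers m : cone m -> (\sum_(I <- layers m) ideal_mon I)%MM = m.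
Proof.
move=> /coneP mP; apply: expo_inj => a; rewrite expo_sum big_map.
under eq_bigr do rewrite expo_ideal.
case: a => [[x|]|].
- under eq_bigr do rewrite inE.
  by rewrite count_lt_iota // (mP bot (emb x)).
- by rewrite big1.
- by rewrite sum1_size size_iota.
Qed.

(** * The Hibi ring and its splittings *)

Section Polynomials.
Variable k : fieldType.
Local Open Scope ring_scope.
Local Notation poly := {mpoly k[#|P|.+1]}.
Implicit Types (f g : poly) (A B C : mon -> bool).

Lemma hibi_genE (I : {set P}) : hibi_gen k I = 'X_[ideal_mon I].
Proof.
rewrite /hibi_gen /varX mprodXE -mpolyXD; congr 'X_[_].
apply: expo_inj => a; rewrite expoD expo_ideal.
rewrite (big_morph (expo^~ a) (fun m1 m2 => expoD m1 m2 a) (expo0 a)).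
case: a => [[x|]|] /=.
- rewrite mnm1E /=.
  under eq_bigr do rewrite mnm1E (inj_eq lift_inj) (inj_eq enum_rank_inj).
  case: (boolP (x \in I)) => [Ix|notIx].
    by rewrite (bigD1 x) //= eqxx big1 // => y /andP[_ /negPf->].
  rewrite big1 // => y Iy; case: eqP => // eq_y; by rewrite -eq_y Iy in notIx.
- by rewrite big1.
- by rewrite mnm1E eqxx big1 // => y _; rewrite mnm1E.
Qed.

Lemma layers_prod m : cone m -> \prod_(I <- layers m) hibi_gen k I = 'X_[m].
Proof.
move=> mP; rewrite -[in RHS](sum_layers mP) -mprodXE.
by apply: eq_bigr => I _; rewrite hibi_genE.
Qed.

Definition supported (A : mon -> bool) (f : poly) := forall m, m \in msupp f -> A m.

Lemma supported_sum (I : eqType) (r : seq I) (F : I -> poly) A :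
  (forall i, i \in r -> supported A (F i)) -> supported A (\sum_(i <- r) F i).
Proof.
move=> FP; rewrite big_seq; elim/big_rec: _ => [|i f ri fP] m; first by rewrite msupp0.
by move/msuppD_le; rewrite mem_cat => /orP[/(FP i ri)|/fP].
Qed.

Lemma supportedZ c f A : supported A f -> supported A (c *: f).
Proof. by move=> fP m /msuppZ_le/fP. Qed.

Lemma supportedM f g A B C : (forall m1 m2, A m1 -> B m2 -> C (m1 + m2)%MM) ->
  supported A f -> supported B g -> supported C (f * g).
Proof.
move=> AB fP gP m /msuppM_le/allpairsP[[m1 m2] /= [fm gm ->]].
by apply: AB; [apply: fP | apply: gP].
Qed.

Lemma supported_prod (r : seq poly) :
  (forall f, f \in r -> supported (fun m => 0 < m ord0)%N f) ->
  supported (fun m => size r <= m ord0)%N (\prod_(f <- r) f).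
Proof.
elim: r => [|f r IHr] rP; first by rewrite big_nil => m _.
rewrite big_cons /=; apply: (@supportedM _ _ (fun m => 0 < m ord0)%N
  (fun m => size r <= m ord0)%N) => [m1 m2 /=||].
- by rewrite mnmDE; lia.
- by apply: rP; rewrite mem_head.
- by apply: IHr => g rg; apply: rP; rewrite in_cons rg orbT.
Qed.

(** The cone contains the exponents of the generators and is closed under addition; conversely,
    [layers] factors each of its monomials into generators. *)
Lemma inR_cone f : inR f <-> supported cone f.
Proof.
split=> [[l [idl ->]]|fP].
  apply: supported_sum => cs lcs; apply: supportedZ => m.
  rewrite (eq_bigr (fun I => 'X_[ideal_mon I])) => [|I _]; last exact: hibi_genE.
  rewrite mprodXE => /mem_msuppXP <-; rewrite big_seq.
  elim/big_rec: _ => [|I m' csI]; first exact: cone0.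
  exact/coneD/cone_ideal/(idl cs).
exists [seq (f@_m, layers m) | m <- msupp f]; split.
  by move=> cs /mapP[m fm ->]; apply: layers_ideal; apply: fP.
rewrite big_map {1}[f]mpolyE !big_seq; apply: eq_bigr => m fm /=.
by rewrite layers_prod ?fP.
Qed.

Lemma inRX m : inR ('X_[m] : poly) <-> cone m.
Proof.
rewrite inR_cone; split=> [|mP m' /mem_msuppXP <- //].
by apply; rewrite msuppX mem_head.
Qed.

Lemma inRD f g : inR f -> inR g -> inR (f + g : poly).
Proof.
move=> /inR_cone fP /inR_cone gP; apply/inR_cone=> m.
by move/msuppD_le; rewrite mem_cat => /orP[/fP|/gP].
Qed.

Lemma inRZ c f : inR f -> inR (c *: f : poly).
Proof. by move=> /inR_cone fP; apply/inR_cone/supportedZ. Qed.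

Lemma inRM f g : inR f -> inR g -> inR (f * g : poly).
Proof.
move=> /inR_cone fP /inR_cone gP; apply/inR_cone.
exact: (supportedM coneD fP gP).
Qed.

Lemma inMpow_degree a f : inMpow a f ->
  inR f /\ supported (fun m => a <= m ord0)%N (f : poly).
Proof.
case=> l [lP ->]; split; last first.
  apply: supported_sum => -[r s] /lP /= [_ [<- sP]] /=.
  apply: (@supportedM _ _ xpredT (fun m => size s <= m ord0)%N) => [m1 m2 _ /=|m //|].
    by rewrite mnmDE; lia.
  by apply: (@supported_prod s) => x /sP [].
rewrite big_seq; elim/big_rec: _ => [|[r s] f' /lP /= [rP [_ sP]]].
  by apply/inR_cone=> m; rewrite msupp0.
apply: inRD; apply: inRM => //; rewrite big_seq.
elim/big_rec: _ => [|x f'' /sP[xP _]]; last exact: inRM.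
by rewrite -mpolyX0; apply/inRX/cone0.
Qed.

Lemma mon_inMpow m : cone m -> inMpow (m ord0) ('X_[m] : poly).
Proof.
move=> mP; exists [:: (1, [seq hibi_gen k J | J <- layers m])]; split=> [rx|]; last first.
  by rewrite big_seq1 mul1r big_map layers_prod.
rewrite inE => /eqP->; split; first by rewrite -mpolyX0; apply/inRX/cone0.
split=> [|x]; first by rewrite size_map size_layers.
case/mapP=> I mI ->; rewrite hibi_genE; split.
  exact/inRX/cone_ideal/(layers_ideal mP).
by move=> m' /mem_msuppXP <-; rewrite -[_ ord0]/(expo _ bot) expo_ideal.
Qed.

(** * Splittings of Frobenius powers *)

Section Frobenius.
Variables (p : nat).
Hypotheses (p_prime : prime p) (p_char : p \in [pchar k])
  (k_perfect : forall x : k, exists y, y ^+ p = x).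

Lemma pchar_mpoly : p \in [pchar poly].
Proof. exact: (rmorph_pchar (@mpolyC #|P|.+1 k)). Qed.

Variable e : nat.
Local Notation q := (p ^ e)%N.

Lemma q_gt0 : (0 < q)%N. Proof. by rewrite expn_gt0 prime_gt0. Qed.

Section Split.
Variable dist : bar -> nat.
Hypotheses (dist_top : dist top = 0%N)
  (dist_cov : forall a b, pcov ble a b -> (dist a <= dist b + 1 /\ dist b <= dist a)%N).

Local Notation u := (mon_of (fun a => dist a * q.-1)%N).

Lemma expo_u a : expo u a = (dist a * q.-1)%N.
Proof. by rewrite expo_mon_of // dist_top. Qed.

Lemma cone_u : cone u.
Proof.
apply/coneP; apply: (ple_ind Pbar_le_anti Pbar_le_trans) => [a b cab|//|b a c ab bc].
  by rewrite !expo_u leq_mul2r (dist_cov cab).2 orbT.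
exact: leq_trans bc ab.
Qed.

(** The equation says [v = u + q (w - m)] without subtraction. Along a cover [u] drops by at most
    [q - 1], which cannot absorb a rise of [q (w - m)] by [q] or more; so the integral function
    [w - m] is order-reversing. *)
Lemma cone_quotient w m v : (u + w *+ q = m *+ q + v)%MM -> cone v ->
  forall a b, ble a b -> (expo w b + expo m a <= expo w a + expo m b)%N.
Proof.
move=> eq_v /coneP vP.
apply: (ple_ind Pbar_le_anti Pbar_le_trans) => [a b cab|a|b a c]; [|by rewrite addnC|lia].
have := vP a b (plt_le (pcov_plt cab)); have [dab dba] := dist_cov cab.
have := congr1 (expo^~ a) eq_v; have := congr1 (expo^~ b) eq_v.
rewrite /= !expoD !expoMn !expo_u; have := q_gt0; move: q => Q Q_gt0.
move=> eqb eqa le_v; rewrite leqNgt; apply/negP=> lt_w.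
have : ((expo w a + expo m b).+1 * Q <= (expo w b + expo m a) * Q)%N.
  by rewrite leq_mul2r lt_w orbT.
have : (dist a * Q.-1 <= (dist b + 1) * Q.-1)%N by rewrite leq_mul2r dab orbT.
by nia.
Qed.

Lemma cone_descent w : cone (u + w *+ q)%MM -> cone w.
Proof.
move=> uwP; apply/coneP=> a b ab.
have := @cone_quotient w 0%MM (u + w *+ q)%MM _ uwP a b ab.
by rewrite !expo0 !addn0; apply; apply: expo_inj => c; rewrite [RHS]expoD expoMn expo0.
Qed.

(* The splitting takes the part of [g / X^u] with exponents divisible by [q] and
   extracts its [q]-th root. *)
Lemma monomial_splits : splits_at q ('X_[u] : poly).
Proof.
have [rt [rt1 rtD rtM]] := root_semilinear p_prime p_char k_perfect e.
have rt0 : rt 0 = 0 by have := rtM 0 0; rewrite mulr0 mul0r.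
(* The bound [msize g] only makes the sum finite: beyond it the coefficient at [u + w *+ q] is zero,
   because [q] is positive. *)
pose phi (g : poly) : poly :=
  \sum_(w : 'X_{1..#|P|.+1 < msize g}) rt g@_(u + w *+ q) *: 'X_[w].
have phiE g w : (phi g)@_w = rt g@_(u + w *+ q).
  have [lt_w|le_w] := ltnP (mdeg w) (msize g).
    exact: (mcoeff_mpoly (fun w => rt g@_(u + w *+ q))).
  rewrite raddf_sum big1 /= => [|w' _].
    rewrite memN_msupp_eq0 ?rt0 //; apply/msize_mdeg_ge/(leq_trans le_w).
    by rewrite mdegD mdegMn (leq_trans (leq_pmulr _ q_gt0)) // leq_addl.
  rewrite mcoeffZ mcoeffX; case: eqP => [eq_w|_]; last by rewrite mulr0.
  by have := bmdeg w'; rewrite eq_w ltnNge le_w.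
have phiD x y : phi (x + y) = phi x + phi y.
  by apply/mpolyP=> w; rewrite mcoeffD !phiE mcoeffD rtD.
have phi0 : phi 0 = 0 by apply/mpolyP=> w; rewrite phiE !mcoeff0 rt0.
exists phi; split=> [x /inR_cone xP|x y _ _|r x rP /inR_cone xP|].
- apply/inR_cone=> w; rewrite mcoeff_msupp phiE => nz_x; apply: cone_descent.
  by apply: xP; rewrite mcoeff_msupp; apply: contraNneq nz_x => ->; rewrite rt0.
- exact: phiD.
(* Since [q]-th powers are additive in characteristic [p], it suffices to treat the terms of [r] one
   by one. *)
- move/inR_cone: rP => rP; rewrite [r]mpolyE big_seq.
  elim/big_rec: _ => [|m s rm IHs].
    by rewrite expr0n gtn_eqF ?q_gt0 // !mul0r phi0.
  rewrite exprD_pchar_pow ?pchar_mpoly // mulrDl phiD IHs mulrDl; congr (_ + _).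
  apply/mpolyP=> w; rewrite phiE exprZn mpolyXn -!scalerAl !mcoeffZ rtM; congr (_ * _).
  rewrite -!(commr_mpolyX _ _) ?(mulrC 'X_[_]).
  (* Comparison with the top, where all exponents vanish, gives divisibility. If [m] does not divide
     [w], both coefficients to be compared are therefore zero. *)
  have quot v : (u + w *+ q = m *+ q + v)%MM -> cone v -> (m <= w)%MM.
    move=> eq_v vP; have le_mw := cone_quotient eq_v vP.
    apply/mnm_lepP=> i; case: (unliftP ord0 i) => [j ->|->].
      by have := le_mw (emb (enum_val j)) top isT; rewrite /= enum_valK addn0.
    by have := le_mw bot top isT; rewrite /= addn0.
  case: (boolP (m <= w)%MM) => [le_mw|not_mw].
    have -> : w = (m + (w - m))%MM by rewrite addmC submK.
    rewrite mcoeffMX phiE.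
    have -> : (u + (m + (w - m)) *+ q = m *+ q + (u + (w - m) *+ q))%MM.
      by apply: expo_inj => a; rewrite !(expoD, expoMn); lia.
    by rewrite mcoeffMX.
  rewrite !memN_msupp_eq0 ?rt0 // (perm_mem (msuppMX _ _)).
    by apply: contra not_mw => /mapP[v _ ->]; apply: lem_addr.
  by apply: contra not_mw => /mapP[v xv eq_v]; apply: quot eq_v (xP _ xv).
- apply/mpolyP=> w; rewrite phiE mcoeffX mcoeff1.
  have -> : (u == u + w *+ q)%MM = (w == 0%MM).
    apply/eqP/eqP => [eq_u|->]; apply: expo_inj => a; last first.
      by rewrite expoD expoMn expo0 mul0n addn0.
    have := congr1 (expo^~ a) eq_u; rewrite /= expoD expoMn expo0.
    by have := q_gt0; nia.
  by case: (w == _); rewrite ?rt1.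
Qed.

End Split.

(* Otherwise [gap_exchange] makes [X^w] divide [X^s], whereas [s] is constant and
   [w] drops by one on the pair [x < y]. *)
Lemma splitting_gap (phi : poly -> poly) m :
    (forall g, inR g -> inR (phi g)) ->
    (forall r g, inR r -> inR g -> phi (r ^+ q * g) = r * phi g) ->
    cone m -> (phi 'X_[m])@_0 != 0 ->
  forall x y, pcov ble x y -> (expo m x < expo m y + q)%N.
Proof.
move=> phiR phiM mP nz_m x y cxy; rewrite ltnNge; apply/negP=> gap.
have [s [w [m' [[sP wP m'P] eq_m' [sxy w_x w_y]]]]] := gap_exchange cxy mP gap.
have eq_phi : 'X_[s] * phi 'X_[m] = 'X_[w] * phi 'X_[m'].
  by rewrite -!phiM; [rewrite !mpolyXn -!mpolyXD eq_m'|exact/inRX..].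
(* The nonzero constant term of [phi 'X_[m]] makes ['X_[s]] occur in the product. *)
have : s \in msupp (phi 'X_[m'] * 'X_[w]).
  by rewrite mcoeff_msupp mulrC -eq_phi mulrC -[s in _@_s]addm0 mcoeffMX.
rewrite (perm_mem (msuppMX _ _)) => /mapP[v v_phi eq_s].
have vP : cone v by move: v v_phi {eq_s}; apply/inR_cone/phiR/inRX.
have := coneP _ vP x y (plt_le (pcov_plt cxy)).
have := congr1 (expo^~ x) eq_s; have := congr1 (expo^~ y) eq_s.
by rewrite /= !expoD w_x w_y sxy; clear; lia.
Qed.

(** Some monomial of [f] must have an image with nonzero constant term, as [phi f = 1];
    [splitting_gap] applies to it. Coefficients do not interfere: each is a [q]-th power, whose root
    comes out of [phi]. *)
Lemma splitting_monomial f : inR f -> splits_at q f ->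
  exists2 m, m \in msupp f
    & forall x y, pcov ble x y -> (expo m x < expo m y + q)%N.
Proof.
move=> /inR_cone fR [phi [phiR phiD phiM phi_f]].
have in0 : inR (0 : poly) by apply/inR_cone=> m; rewrite msupp0.
have phi0 : phi 0 = 0 by apply: (addrI (phi 0)); rewrite -phiD // !addr0.
have /allPn[m fm nz_m] : ~~ all (fun m => (phi 'X_[m])@_0 == 0) (msupp f).
  apply/negP=> /allP all0; move/(congr1 (mcoeff 0%MM))/esym/eqP: phi_f.
  rewrite mcoeff1 eqxx [f]mpolyE big_seq.
  suff [] : inR (\sum_(m <- msupp f | m \in msupp f) f@_m *: 'X_[m] : poly) /\
     (phi (\sum_(m <- msupp f | m \in msupp f) f@_m *: 'X_[m]))@_0 = 0.
    by move=> _ ->; rewrite oner_eq0.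
  elim/big_rec: _ => [|m g fm [gR g0]]; first by rewrite phi0 mcoeff0.
  have mR : inR ('X_[m] : poly) by apply/inRX/fR.
  split; first exact/inRD/gR/inRZ.
  rewrite phiD //; last exact: inRZ.
  have [c <-] := root_exists k_perfect e f@_m.
  rewrite mcoeffD g0 addr0 -mul_mpolyC rmorphXn phiM //; last first.
    by rewrite /= -[_%:MP]mulr1 mul_mpolyC -mpolyX0; apply/inRZ/inRX/cone0.
  by rewrite /= mcoeffCM (eqP (all0 m fm)) mulr0.
exists m => // x y; apply: (@splitting_gap phi) => //; exact: fR.
Qed.

End Frobenius.
End Polynomials.
End Bar.

(** * The F-pure threshold *)

Theorem theorem3p9 (k : fieldType) (p : nat) (d : Order.disp_t)
  (P : finPOrderType d) :
  prime p -> p \in [pchar k]%R -> (forall x : k, exists y : k, (y ^+ p)%R = x) ->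
  (0 < #|P|)%N ->
  exists r : nat,
    lower_rank_is (@P_le d P) r /\
    lower_rank_is (@Pbar_le d P) (r + 2) /\
    fpt_is k P p (INR (r + 2)).
Proof.
move=> p_prime p_char k_perfect P_gt0.
have [r [rankP rankB minB [s [walkB upsB]]]] := lower_rank_bar P_gt0.
exists r; split=> //; split=> //; split=> [t [t_ge0 [e0 pure]]|c ubc].
  (* A single exponent suffices for the upper bound; taking it positive allows division by
     [q - 1]. *)
  pose e := maxn e0 1; have q_gt1 : 1 < p ^ e.
    by rewrite -(expn0 p) ltn_exp2l ?prime_gt1 // leq_maxr.
  have [a [_ [le_ta [f [fa split_f]]]]] := pure e (leq_maxl _ _).
  have [fR f_deg] := inMpow_degree fa.
  have [m fm gap] := splitting_monomial k_perfect fR split_f.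
  have mP : cone m by move/inR_cone: fR; apply.
  (* The degree of [m] is its value at the bottom, which weak duality along the optimal walk
     bounds. *)
  have le_a : a <= (r + 2) * (p ^ e).-1.
    apply: leq_trans (f_deg m fm) _; rewrite mulnC -upsB.
    have [_ ps] := walkB; rewrite pmaximal_bar => /eqP ls.
    have := leq_ups (Pbar_le_anti (P := P)) (@Pbar_le_trans d P)
      (f := expo m) (c := (p ^ e).-1) _ ps; rewrite ls; apply=> x y cxy.
    split; last exact: (coneP _ mP _ _ (plt_le (pcov_plt cxy))).
    by have := gap x y cxy; lia.
  have INR_pred : Rminus (INR (p ^ e)) R1 = INR (p ^ e).-1.
    by rewrite -{1}(ltn_predK q_gt1) S_INR; lra.
  have q_gt0 : Rlt 0 (INR (p ^ e).-1) by apply: (lt_INR 0); lia.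
  apply: (Rmult_le_reg_r _ _ _ q_gt0); rewrite -INR_pred.
  apply: Rle_trans le_ta _; rewrite INR_pred -mult_INR.
  by apply: le_INR; lia.
(* The supremum is attained: [r + 2] itself gives an F-pure pair. The witness is [q - 1] times the
   potential, whose degree is exactly [(r + 2)(q - 1)], an integer, so the ceiling changes
   nothing. *)
apply: ubc; split; first exact: pos_INR.
exists 0 => e _; have q_gt0 : 0 < p ^ e by rewrite expn_gt0 prime_gt0.
have [dist [dist_top dist_bot dist_cov]] :=
  bar_potential minB (ex_intro _ s (conj walkB upsB)).
pose u : 'X_{1..#|P|.+1} := mon_of (fun a => dist a * (p ^ e).-1).
have u_bot : u ord0 = (r + 2) * (p ^ e).-1.
  by rewrite -[u ord0]/(expo u None) expo_mon_of ?dist_top ?dist_bot.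
have eq_a : Rmult (INR (r + 2)) (Rminus (INR (p ^ e)) R1) =
            INR ((r + 2) * (p ^ e).-1).
  rewrite mult_INR; congr Rmult.
  by rewrite -{1}(prednK q_gt0) S_INR; lra.
exists ((r + 2) * (p ^ e).-1); rewrite eq_a; split; first lra.
split; first exact: Rle_refl.
exists 'X_[u]%R; split; first by rewrite -u_bot; apply/mon_inMpow/cone_u.
exact: monomial_splits.
Qed.
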